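(* Let $A=\{a,b,c\}$ and let $N_i$ ($N\in\{0,1,2\}$, $i\in A$) be nine distinct atoms in $P$ (read ''agent $i$ holds card $N$''). Let $B_{cards}$ be the base consisting of all rules $N_i,N_j\Rightarrow p$ and $N_i,M_i\Rightarrow p$ for all $M,N\in\{0,1,2\}$ with $M\neq N$, all $i,j\in A$ with $i\neq j$, and all $p\in P$. For $M,N,L$ with $\{M,N,L\}=\{0,1,2\}$ let $B_{MNL}$ denote any consistent superset of $B_{cards}$ such that $\Vdash_{B_{MNL},R_A}M_a\wedge N_b\wedge L_c$. Let $R_A$ be any update set on $\Omega_P$ for which there are such bases $B_{012},B_{021},B_{102},B_{120},B_{201},B_{210}$ with $$R_aB_{012}B_{021},\quad R_aB_{102}B_{120},\quad R_aB_{201}B_{210},$$ $$R_bB_{102}B_{201},\quad R_bB_{012}B_{210},\quad R_bB_{021}B_{120},$$ $$R_cB_{120}B_{210},\quad R_cB_{021}B_{201},\quad R_cB_{012}B_{102},$$ and such that these, together with the relations necessary to make $R_a,R_b,R_c$ reflexive, transitive and Euclidean, are the only relations involving these six bases. Then $$\Vdash_{B_{012},R_A}[\neg 1_a]K_c(0_a\wedge 1_b\wedge 2_c).$$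
   Context: Fix a countably infinite initial set $P$ of atoms and a set $A$ of agents. Formulas of public announcement logic (PAL): $\phi::=p\mid\bot\mid\phi\to\phi\mid K_a\phi\mid[\phi]\phi$ with $p\in P$, $a\in A$. $\neg\phi:=\phi\to\bot$, $\phi\wedge\psi:=\neg(\phi\to\neg\psi)$. Bases. Let $Q\supseteq P$ be a countably infinite set of atoms. A base rule over $Q$ is $p_1,\dots,p_n\Rightarrow p$ with $\{p_1,\dots,p_n\}\subseteq Q$ finite (possibly empty) and $p\in Q$. A base is a countable set of base rules; $\Omega_Q$ is the set of bases over $Q$. $\overline{B}$ is the closure of the empty set under the rules of $B$. $B\in\Omega_Q$ is inconsistent if $\overline{B}=Q$, otherwise consistent. $S5$-modal relations. A binary relation $R_a$ on $\Omega_Q$ is an $S5$-modal relation if it is reflexive, transitive and Euclidean and for all $B$: (a) if $B$ is inconsistent, then there is an inconsistent $C$ with $R_aBC$, and every $D$ with $R_aBD$ is inconsistent; (b) if $B$ is consistent, every $C$ with $R_aBC$ is consistent; (c) for all $C$, if $R_aBC$, then for all consistent $D\supseteq B$ there is $E\supseteq C$ with $R_aDE$; (d) for all consistent $C$, if $R_aBC$, then for all $D\subseteq B$ there is $E\subseteq C$ with $R_aDE$. Reachability. Given $R_A=\{R_a\}_{a\in A}$, $C$ is reachable from $B$ (by $R_A$) if there is a finite chain of bases from $B$ to $C$ with consecutive bases related by some $R_a$, $a\in A$. $C$ is reachable from $B$ using the sub/superset relation if there is a finite chain of bases from $B$ to $C$ with consecutive bases related by $\subseteq$ or $\supseteq$.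 Update sets. $R_A=\{R_a\}_{a\in A}$ is an update set on $\Omega_Q$ if: all $R_a$ are $S5$-modal relations; for all consistent $B,B'$ with $B'$ reachable from $B$ and $B'\subseteq B$, all $a\in A$ and all $C$, $R_aBC$ iff $R_aB'C$; and for every consistent $B$ there is a finite set $\pi(B)=\{\pi_1,\dots,\pi_n\}$ with each $\pi_i\subseteq\Omega_Q$, such that for all $i$ and $C,D\in\pi_i$, $D$ is reachable from $C$ using the sub/superset relation, and for all $C$, $C$ is reachable from $B$ by $R_A$ iff $C\in\pi_i$ for some $i$. The next two notions are defined simultaneously, by recursion on formulas. Effective updates. Let $R_A$ be an update set on $\Omega_Q$, $B\in\Omega_Q$, $\phi$ a formula. An update set $R'_A$ on $\Omega_{Q'}$ is an effective update of $R_A$ by $\phi$ at $B$ iff $Q'\supseteq Q$ and there is an assignment $C\mapsto C^+$ giving to every $C$ reachable from $B$ by $R_A$ a base $C^+\in\Omega_{Q'}$, $C^+\supseteq C$, such that: for all classical formulas $\theta$ (built with $\to,\bot$) with atoms in $Q$, $\Vdash_{C^+,R'_A}\theta$ iff $\Vdash_{C,R_A}\theta$; and for all $a\in A$ and all $C\ne D$ reachable from $B$ by $R_A$, $R'_aC^+D^+$ iff ($R_aCD$, $\Vdash_{C,R_A}\phi$ and $\Vdash_{D,R_A}\phi$). Such a $C^+$ is called an update of $C$ for $R'_A$. $R_A|\phi^B$ is the set of effective updates of $R_A$ by $\phi$ at $B$. For a sequence $\Delta=\phi_1;\dots;\phi_n$, $R_A|\Delta^B$ is obtained by iteration: update $R_A$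 by $\phi_1$ at $B$, then the result by $\phi_2$ at the corresponding update of $B$, and so on; updates of a base for a member of $R_A|\Delta^B$ are the corresponding iterated updates. Support $\Vdash^{\Delta}_{B,R_A}$ ($\Delta$ a possibly empty finite sequence of formulas, omitted if empty): $\Vdash^{\Delta}_{B,R_A}p$ iff $p\in\overline{B}$; $\Vdash^{\Delta}_{B,R_A}\phi\to\psi$ iff $\phi\Vdash^{\Delta}_{B,R_A}\psi$; $\Vdash^{\Delta}_{B,R_A}\bot$ iff $\Vdash^{\Delta}_{B,R_A}p$ for all $p\in P$ (the initial set of atoms); if $\Delta$ is empty, $\Vdash_{B,R_A}K_a\phi$ iff $\Vdash_{B',R_A}\phi$ for all $B'$ with $R_aBB'$; if $\Delta$ is nonempty, $\Vdash^{\Delta}_{B,R_A}K_a\phi$ iff for all $C\supseteq B$, all $R'_A\in R_A|\Delta^{C}$ and all bases $C'$, if there are corresponding updates $C^+$ of $C$ and $C'^+$ of $C'$ for $R'_A$ with $R'_aC^+C'^+$, then $\Vdash^{\Delta}_{C',R_A}\phi$; $\Vdash^{\Delta}_{B,R_A}[\phi]\psi$ iff for all $C\supseteq B$, if $\Vdash^{\Delta}_{C,R_A}\phi$ then $\Vdash^{\Delta,\phi}_{C,R_A}\psi$; $\Gamma\Vdash^{\Delta}_{B,R_A}\phi$ iff for all $C\supseteq B$, if $\Vdash^{\Delta}_{C,R_A}\psi$ for all $\psi\in\Gamma$ then $\Vdash^{\Delta}_{C,R_A}\phi$. *)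

(* Defs.v *)
From Stdlib Require Import Relations.
From mathcomp Require Import all_boot finmap.
From mathcomp Require Import classical_sets cardinality.

Set Implicit Arguments.
Unset Strict Implicit.
Unset Printing Implicit Defensive.

Local Open Scope classical_set_scope.

(* U is an ambient supply of atoms: P, Q, Q', ... are countably infinite subsets
   of U.  Results are meant for arbitrary U; when U is uncountable, every such Q
   can be enlarged by countably many fresh atoms. *)

Definition countably_infinite (U : Type) (Q : set U) : Prop :=
  (Q #= [set: nat])%card.

Inductive form (U A : Type) : Type :=
| Atom of U
| Bot
| Imp of form U A & form U A
| Know of A & form U A
| Ann of form U A & form U A.

Arguments Bot {U A}.
Arguments Atom {U A}.

Definition Neg U A (f : form U A) : form U A := Imp f Bot.
Definition And U A (f g : form U A) : form U A := Neg (Imp f (Neg g)).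

(* Classical formulas form a type of their own because effective updates
   quantify over all of them, whatever the announced formula: their support has
   to be available before the recursion that defines support in general.  The
   two notions agree, see supports_classical below. *)
Inductive cform (U : Type) : Type :=
| CAtom of U
| CBot
| CImp of cform U & cform U.

Arguments CBot {U}.

Fixpoint cform_atoms U (t : cform U) : set U :=
  match t with
  | CAtom p => [set p]
  | CBot => set0
  | CImp s t => cform_atoms s `|` cform_atoms t
  end.

Fixpoint cform_form U A (t : cform U) : form U A :=
  match t with
  | CAtom p => Atom p
  | CBot => Bot
  | CImp s t => Imp (cform_form A s) (cform_form A t)
  end.

Section Bases.
Context {U : choiceType}.
Implicit Types (Q : set U).

(* (S, p) is the rule with finite set of premises S and conclusion p. *)
Definition rule : Type := ({fset U} * U)%type.
Definition base : Type := set rule.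
Implicit Types (B C D : base).

Definition rule_over Q (r : rule) : Prop :=
  (forall q, q \in r.1 -> Q q) /\ Q r.2.

Definition Omega Q : set base :=
  [set B | countable B /\ forall r, B r -> rule_over Q r].

Inductive base_closure B : set U :=
| base_closure_rule (r : rule) of
    B r & (forall q, q \in r.1 -> base_closure B q) : base_closure B r.2.

Definition inconsistent Q B : Prop := Omega Q B /\ base_closure B = Q.
Definition consistent Q B : Prop := Omega Q B /\ base_closure B <> Q.

Record S5_modal Q (R : base -> base -> Prop) : Prop := {
  S5_on : forall B C, R B C -> Omega Q B /\ Omega Q C;
  S5_reflexive : forall B, Omega Q B -> R B B;
  S5_transitive : forall B C D, R B C -> R C D -> R B D;
  S5_euclidean : forall B C D, R B C -> R B D -> R C D;
  S5_a : forall B, inconsistent Q B ->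
    (exists C, inconsistent Q C /\ R B C) /\
    (forall D, R B D -> inconsistent Q D);
  S5_b : forall B, consistent Q B -> forall C, R B C -> consistent Q C;
  S5_c : forall B C, R B C ->
    forall D, consistent Q D -> B `<=` D -> exists E, C `<=` E /\ R D E;
  S5_d : forall B C, consistent Q C -> R B C ->
    forall D, Omega Q D -> D `<=` B -> exists E, E `<=` C /\ R D E
}.

Definition subsup_reachable Q : base -> base -> Prop :=
  clos_refl_trans base
    (fun B C => [/\ Omega Q B, Omega Q C & B `<=` C \/ C `<=` B]).

Fixpoint csupport (P Q : set U) (t : cform U) B : Prop :=
  match t with
  | CAtom p => base_closure B p
  | CBot => forall p, P p -> base_closure B p
  | CImp s t => forall C, Omega Q C -> B `<=` C ->
                  csupport P Q s C -> csupport P Q t C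
  end.

End Bases.

Arguments base : clear implicits.
Arguments rule : clear implicits.

(* The atoms Q are carried along with the relations on Omega Q because updates
   may enlarge them. *)
Record relations (U : choiceType) (A : Type) := Relations {
  atoms : set U;
  rel_of : A -> base U -> base U -> Prop
}.

Section Support.
Context {U : choiceType} {A : Type}.
(* P is the initial set of atoms. *)
Variable P : set U.
Implicit Types (B C D : base U) (R : relations U A) (a : A).

Definition reachable R : base U -> base U -> Prop :=
  clos_refl_trans (base U) (fun B C => exists a, rel_of R a B C).

Record update_set R : Prop := {
  update_atoms : P `<=` atoms R /\ countably_infinite (atoms R);
  update_S5 : forall a, S5_modal (atoms R) (rel_of R a);
  update_sub : forall B B', consistent (atoms R) B -> consistent (atoms R) B' ->
    reachable R B B' -> B' `<=` B ->
    forall a C, rel_of R a B C <-> rel_of R a B' C;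
  update_finite : forall B, consistent (atoms R) B ->
    exists pi : set (set (base U)),
      [/\ finite_set pi,
          forall X, pi X -> X `<=` Omega (atoms R),
          forall X C D, pi X -> X C -> X D -> subsup_reachable (atoms R) C D
        & forall C, reachable R B C <-> exists X, pi X /\ X C]
}.

(* The denotation of a formula phi is R, B |-> (B supports phi w.r.t. R),
   for the empty sequence of announcements. *)
Definition denotation : Type := relations U A -> base U -> Prop.

(* R' is an effective update of R at B by the formula with denotation V, as
   witnessed by the assignment plus, of which only the values at the bases
   reachable from B matter. *)
Definition effective_update (V : denotation) R B R' (plus : base U -> base U)
    : Prop :=
  [/\ update_set R',
      atoms R `<=` atoms R',
      forall C, reachable R B C -> Omega (atoms R') (plus C) /\ C `<=` plus C,
      forall C, reachable R B C -> forall t, cform_atoms t `<=` atoms R ->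
        (csupport P (atoms R') t (plus C) <-> csupport P (atoms R) t C)
    & forall a C D, reachable R B C -> reachable R B D -> C <> D ->
        (rel_of R' a (plus C) (plus D) <-> [/\ rel_of R a C D, V R C & V R D])].

(* iterated_update Vs R B R' upd: R' results from updating R at B by the
   formulas with denotations Vs, from left to right; upd C C' says that C' is
   the update of C for R' under the assignments chosen along the way, so that
   pairs related by one and the same upd are corresponding updates. *)
Inductive iterated_update :
    seq denotation -> relations U A -> base U -> relations U A ->
    (base U -> base U -> Prop) -> Prop :=
| iterated_update_nil R B :
    iterated_update [::] R B R (fun C C' => C' = C)
| iterated_update_cons V Vs R B R1 plus R' upd :
    effective_update V R B R1 plus ->
    iterated_update Vs R1 (plus B) R' upd ->
    iterated_update (V :: Vs) R B R'
      (fun C C' => reachable R B C /\ upd (plus C) C').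

(* Support and effective updates are defined by simultaneous recursion.  An
   effective update by phi depends on phi only through its support for the empty
   sequence, so the recursion can be made structural by keeping, instead of the
   sequence of announced formulas, the sequence of their denotations. *)
Fixpoint support_at (phi : form U A) (Vs : seq denotation) R B {struct phi}
    : Prop :=
  match phi with
  | Atom p => base_closure B p
  | Bot => forall p, P p -> base_closure B p
  | Imp f g => forall C, Omega (atoms R) C -> B `<=` C ->
      support_at f Vs R C -> support_at g Vs R C
  | Know a f =>
      match Vs with
      | [::] => forall B', rel_of R a B B' -> support_at f [::] R B'
      | _ :: _ => forall C, Omega (atoms R) C -> B `<=` C ->
          forall R' upd, iterated_update Vs R C R' upd ->
          forall C', Omega (atoms R) C' ->
            (exists Cp Cp', [/\ upd C Cp, upd C' Cp' & rel_of R' a Cp Cp']) ->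
            support_at f Vs R C'
      end
  | Ann f g => forall C, Omega (atoms R) C -> B `<=` C ->
      support_at f Vs R C -> support_at g (rcons Vs (support_at f [::])) R C
  end.

Definition denote (phi : form U A) : denotation := support_at phi [::].

Definition supports (Delta : seq (form U A)) R B (phi : form U A) : Prop :=
  support_at phi [seq denote psi | psi <- Delta] R B.

Definition update_by (Delta : seq (form U A)) R B R' upd : Prop :=
  iterated_update [seq denote psi | psi <- Delta] R B R' upd.

Lemma supports_atom Delta R B p : supports Delta R B (Atom p) <-> base_closure B p.
Proof. by []. Qed.

Lemma supports_bot Delta R B :
  supports Delta R B Bot <-> forall p, P p -> supports Delta R B (Atom p).
Proof. by []. Qed.

Lemma supports_imp Delta R B f g :
  supports Delta R B (Imp f g) <->
  forall C, Omega (atoms R) C -> B `<=` C ->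
    supports Delta R C f -> supports Delta R C g.
Proof. by []. Qed.

Lemma supports_know_nil R B a f :
  supports [::] R B (Know a f) <->
  forall B', rel_of R a B B' -> supports [::] R B' f.
Proof. by []. Qed.

Lemma supports_know_cons psi Delta R B a f :
  supports (psi :: Delta) R B (Know a f) <->
  forall C, Omega (atoms R) C -> B `<=` C ->
  forall R' upd, update_by (psi :: Delta) R C R' upd ->
  forall C', Omega (atoms R) C' ->
    (exists Cp Cp', [/\ upd C Cp, upd C' Cp' & rel_of R' a Cp Cp']) ->
    supports (psi :: Delta) R C' f.
Proof. by []. Qed.

Lemma supports_ann Delta R B f g :
  supports Delta R B (Ann f g) <->
  forall C, Omega (atoms R) C -> B `<=` C ->
    supports Delta R C f -> supports (rcons Delta f) R C g.
Proof. by rewrite /supports map_rcons. Qed.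

Lemma supports_classical Delta R B (t : cform U) :
  supports Delta R B (cform_form A t) <-> csupport P (atoms R) t B.
Proof.
rewrite /supports; elim: t B => [p|//|s IHs t IHt] B //=.
by split=> H C OC BC /IHs sC; apply/IHt/H.
Qed.

End Support.

Inductive S5_closure (T : Type) (L : set (T * T)) : T -> T -> Prop :=
| S5_closure_base x y of L (x, y) : S5_closure L x y
| S5_closure_refl x : S5_closure L x x
| S5_closure_trans x y z of
    S5_closure L x y & S5_closure L y z : S5_closure L x z
| S5_closure_eucl x y z of
    S5_closure L x y & S5_closure L x z : S5_closure L y z.

Inductive agent : Type := ag_a | ag_b | ag_c.
Inductive playing_card : Type := Card0 | Card1 | Card2.

Section Cards.
Context {U : choiceType}.
Variables (P : set U) (holds : playing_card -> agent -> U).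

Definition B_cards : base U :=
  [set r | exists N i j p, [/\ i <> j, P p &
             r = ([fset holds N i; holds N j]%fset, p)]] `|`
  [set r | exists N M i p, [/\ M <> N, P p &
             r = ([fset holds N i; holds M i]%fset, p)]].

Definition dealt (M N L : playing_card) : form U agent :=
  And (And (Atom (holds M ag_a)) (Atom (holds N ag_b))) (Atom (holds L ag_c)).

Definition is_deal (R : relations U agent) (M N L : playing_card) (B : base U) : Prop :=
  [/\ consistent P B, B_cards `<=` B & supports P [::] R B (dealt M N L)].

End Cards.

(* Main.v *)
Require Import Defs.
From mathcomp Require Import all_boot finmap.
From mathcomp Require Import boolp classical_sets.

Set Implicit Arguments.
Unset Strict Implicit.
Unset Printing Implicit Defensive.

Local Open Scope classical_set_scope.

(** Carol considers two deals possible at [B012], namely 012 and 102, and the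
    announcement rules out the second one.  What has to be checked is that this
    picture, drawn for the six given bases, survives the passage to arbitrary
    supersets [D] of [B012] and arbitrary effective updates.

    An effective update leaves a link between distinct bases [D] and [X] only if
    it was there before and both support the announcement.  If [X] is
    consistent, clause (d) of S5-modal relations pulls such a link for agent c
    down to one from [B012] to some [E] below [X]; the only candidates for [E]
    are [B012] and [B102] ([c_class]).  Over [B012] the deal 012 persists.  Over
    [B102] the atom 1_a holds in the sense of a double negation, which the
    announcement refutes ([refuted_deal]), so that [X] supports absurdity and
    hence the deal 012.

    Conjunction is defined by negation, and the atoms in a supported deal are
    never extracted from it.  All uses have absurdity as their goal, where a
    conjunction may be eliminated as if it were constructive
    ([and_elim_bot]).  This also shows that different deals have different bases
    ([deal_unique]), without which the links for c could merge several classes. *)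

Section Support.
Context {U : choiceType} {A : Type} {P : set U}.
Implicit Types (B C D : base U) (R : relations U A) (f g : form U A).

Lemma base_closure_sub B C :
  B `<=` C -> base_closure B `<=` base_closure C.
Proof.
move=> BC p; elim=> r Br _ IH.
by apply: base_closure_rule IH; apply: BC.
Qed.

Lemma base_closure_over Q B : Omega Q B -> base_closure B `<=` Q.
Proof. by move=> [_ OB] p [r /OB[]]. Qed.

Lemma bot_inconsistent Vs R B :
  Omega P B -> support_at P Bot Vs R B -> ~ consistent P B.
Proof.
move=> OB bot [_]; apply; apply/seteqP; split=> //.
exact: base_closure_over.
Qed.

Lemma support_imp_sub Vs R B C f g :
  B `<=` C -> support_at P (Imp f g) Vs R B -> support_at P (Imp f g) Vs R C.
Proof. by move=> BC fg D OD CD; apply: fg => //; apply: subset_trans CD. Qed.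

Lemma support_neg_bot Vs R B f :
  support_at P Bot Vs R B -> support_at P (Neg f) Vs R B.
Proof. by move=> bot C _ BC _ p /bot; apply: base_closure_sub. Qed.

(** [And f g] negates [Imp f (Neg g)], and the last hypothesis says in effect
    that this implication is supported.  The conjuncts are met at successive
    extensions, so that the persistence of [f] is left to the user. *)
Lemma and_elim_bot Vs R B f g :
  Omega (atoms R) B -> support_at P (And f g) Vs R B ->
  (forall C D, Omega (atoms R) D -> B `<=` C -> C `<=` D ->
     support_at P f Vs R C -> support_at P g Vs R D ->
     support_at P Bot Vs R D) ->
  support_at P Bot Vs R B.
Proof.
move=> OB fg elim; apply: (fg B OB) => // C _ BC fC D OD CD gD.
exact: (elim C D).
Qed.

(** An update by a single formula changes links between distinct bases only, so
    a base linked after the update is the starting point itself or was linked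
    to it before, both of them supporting the formula. *)
Lemma iterated_update1_link (V : denotation) R B R' upd a C Bp Cp :
  iterated_update P [:: V] R B R' upd ->
  upd B Bp -> upd C Cp -> rel_of R' a Bp Cp ->
  C = B \/ [/\ rel_of R a B C, V R B & V R C].
Proof.
move=> it; inversion it as [|V' Vs R0 B0 R1 plus R2 upd1 eff it1]; subst.
inversion it1; subst.
move=> [rB ->] [rC ->] link; have [->|neq] := pselect (C = B); first by left.
by right; case: eff => _ _ _ _ /(_ a B C rB rC)[|/(_ link)] // /esym.
Qed.

End Support.

Section Cards.
Context {U : choiceType} {P : set U} {holds : playing_card -> agent -> U}.
Implicit Types (B C X : base U) (R : relations U agent).

Lemma dealt_sub Vs R M N L B C :
  B `<=` C -> support_at P (dealt holds M N L) Vs R B ->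
  support_at P (dealt holds M N L) Vs R C.
Proof. exact: support_imp_sub. Qed.

Lemma dealt_elim_bot Vs R M N L B :
  Omega (atoms R) B -> support_at P (dealt holds M N L) Vs R B ->
  (forall C, Omega (atoms R) C -> B `<=` C ->
     base_closure C (holds M ag_a) -> base_closure C (holds N ag_b) ->
     base_closure C (holds L ag_c) -> support_at P Bot Vs R C) ->
  support_at P Bot Vs R B.
Proof.
move=> OB deal elim; apply: (and_elim_bot OB deal) => C D OD BC CD ab c.
apply: (and_elim_bot OD (support_imp_sub CD ab)) => E F OF DE EF a b.
have DF := subset_trans DE EF.
apply: elim => //; first exact: subset_trans (subset_trans BC CD) DF.
- exact: base_closure_sub EF _ a.
- exact: base_closure_sub DF _ c.
Qed.

Lemma two_cards_bot Vs R M N i B :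
  B_cards P holds `<=` B -> M <> N ->
  base_closure B (holds M i) -> base_closure B (holds N i) ->
  support_at P Bot Vs R B.
Proof.
move=> cards neq hM hN p Pp.
apply: (base_closure_rule (r := ([fset holds N i; holds M i]%fset, p))).
  by apply: cards; right; exists N, M, i, p.
by move=> q; rewrite /= !inE => /orP[]/eqP->.
Qed.

Lemma deal_unique R M N L M' N' L' B :
  atoms R = P ->
  is_deal P holds R M N L B -> is_deal P holds R M' N' L' B ->
  [/\ M = M', N = N' & L = L'].
Proof.
move=> RP [consB cards d] [_ _ d']; apply: contrapT => differ.
have OB := consB.1; have OB' := OB; rewrite -RP in OB'.
apply: (@bot_inconsistent _ _ P [::] R B OB) consB.
apply: (dealt_elim_bot OB' d) => C OC BC a b c.
apply: (dealt_elim_bot OC (dealt_sub BC d')) => D _ CD a' b' c'.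
have up := base_closure_sub CD.
have cardsD := subset_trans cards (subset_trans BC CD).
have [eM|neq] := pselect (M = M'); last exact: two_cards_bot (up _ a) a'.
have [eN|neq] := pselect (N = N'); last exact: two_cards_bot (up _ b) b'.
have [eL|neq] := pselect (L = L'); last exact: two_cards_bot (up _ c) c'.
by case: differ.
Qed.

Lemma refuted_deal R M N L X :
  Omega (atoms R) X -> support_at P (dealt holds M N L) [::] R X ->
  support_at P (Neg (Atom (holds M ag_a))) [::] R X ->
  support_at P Bot [::] R X.
Proof.
move=> OX deal no; apply: (dealt_elim_bot OX deal) => C OC XC a _ _.
exact: no.
Qed.

End Cards.

Lemma S5_closure_invariant (T : Type) (L : set (T * T)) (I : T -> Prop) :
  (forall x y, L (x, y) -> (I x <-> I y)) ->
  forall x y, S5_closure L x y -> (I x <-> I y).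
Proof.
move=> inv x y; elim=> {x y} [x y /inv //|x|x y z _ ? _ ?|x y z _ ? _ ?];
  tauto.
Qed.

(** The class of [B012] under the links for c does not grow beyond its one
    link as long as the four bases of the other links are different from it. *)
Lemma c_class (T : Type) (x y u v z w e : T) :
  [/\ u <> x, u <> y, v <> x & v <> y] ->
  [/\ z <> x, z <> y, w <> x & w <> y] ->
  S5_closure [set (u, v); (z, w); (x, y)] x e -> e = x \/ e = y.
Proof.
move=> [? ? ? ?] [? ? ? ?] cl.
apply/(S5_closure_invariant (I := fun t => t = x \/ t = y) _ cl); last by left.
by move=> s t [[[-> ->]|[-> ->]]|[-> ->]]; tauto.
Qed.

Theorem proposition1 (U : choiceType) (P : set U) (hP : countably_infinite P)
  (holds : playing_card -> agent -> U)
  (holds_P : forall N i, P (holds N i))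
  (holds_distinct : forall N i M j, holds N i = holds M j -> N = M /\ i = j)
  (R : relations U agent) (R_update : update_set P R) (R_atoms : atoms R = P)
  (B012 B021 B102 B120 B201 B210 : base U)
  (h012 : is_deal P holds R Card0 Card1 Card2 B012)
  (h021 : is_deal P holds R Card0 Card2 Card1 B021)
  (h102 : is_deal P holds R Card1 Card0 Card2 B102)
  (h120 : is_deal P holds R Card1 Card2 Card0 B120)
  (h201 : is_deal P holds R Card2 Card0 Card1 B201)
  (h210 : is_deal P holds R Card2 Card1 Card0 B210)
  (links_a : [/\ rel_of R ag_a B012 B021, rel_of R ag_a B102 B120
               & rel_of R ag_a B201 B210])
  (links_b : [/\ rel_of R ag_b B102 B201, rel_of R ag_b B012 B210
               & rel_of R ag_b B021 B120])
  (links_c : [/\ rel_of R ag_c B120 B210, rel_of R ag_c B021 B201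
               & rel_of R ag_c B012 B102])
  (only_links : forall X Y : base U,
     let six := [set B012; B021; B102; B120; B201; B210] in
     six X \/ six Y ->
     [/\ rel_of R ag_a X Y ->
           S5_closure [set (B012, B021); (B102, B120); (B201, B210)] X Y,
         rel_of R ag_b X Y ->
           S5_closure [set (B102, B201); (B012, B210); (B021, B120)] X Y
       & rel_of R ag_c X Y ->
           S5_closure [set (B120, B210); (B021, B201); (B012, B102)] X Y]) :
  supports P [::] R B012
    (Ann (Neg (Atom (holds Card1 ag_a)))
         (Know ag_c (dealt holds Card0 Card1 Card2))).
Proof.
move=> C OC subC _ D OD CD R' upd update X OX [Dp [Xp [updD updX RDX]]].
(* The deal is classical: its support is the same after the announcement. *)
change (support_at P (dealt holds Card0 Card1 Card2) [::] R X).
have subD : B012 `<=` D := subset_trans subC CD.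
have [_ _ d012] := h012; have [_ _ d102] := h102.
case: (iterated_update1_link update updD updX RDX) => [->|[RcDX _ annX]].
  exact: dealt_sub subD d012.
have [bot|nbot] := pselect (support_at P Bot [::] R X).
  exact: support_neg_bot.
have consX : consistent (atoms R) X.
  by split=> // clX; apply: nbot => p; rewrite clX R_atoms.
have O012 : Omega (atoms R) B012 by rewrite R_atoms; case: h012 => [[]].
have [E [EX RcE]] := S5_d (update_S5 R_update ag_c) consX RcDX O012 subD.
have six012 : [set B012; B021; B102; B120; B201; B210] B012.
  by do 5 left.
have [_ _ /(_ RcE) clE] := only_links B012 E (or_introl six012).
have [eE|eE] : E = B012 \/ E = B102.
  apply: c_class clE; split=> eq.
  - by rewrite eq in h120; case: (deal_unique R_atoms h120 h012).
  - by rewrite eq in h120; case: (deal_unique R_atoms h120 h102).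
  - by rewrite eq in h210; case: (deal_unique R_atoms h210 h012).
  - by rewrite eq in h210; case: (deal_unique R_atoms h210 h102).
  - by rewrite eq in h021; case: (deal_unique R_atoms h021 h012).
  - by rewrite eq in h021; case: (deal_unique R_atoms h021 h102).
  - by rewrite eq in h201; case: (deal_unique R_atoms h201 h012).
  - by rewrite eq in h201; case: (deal_unique R_atoms h201 h102).
- by apply: dealt_sub d012; rewrite -eE.
- have d102X : support_at P (dealt holds Card1 Card0 Card2) [::] R X.
    by apply: dealt_sub d102; rewrite -eE.
  by case: nbot; apply: refuted_deal OX d102X annX.
Qed.
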